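(* Let $\tau\ge 1$ and let $x[\tau],u[\tau],x[\tau+1]$ be real vectors of the appropriate dimensions satisfying the dynamics $x[\tau+1]=\tilde A x[\tau]+\tilde B u[\tau]$ and the transition constraint $\tilde A_{eq}x[\tau]=0$. Suppose $x[\tau+1]\in \mathrm{null}(\Psi_x[\tau+1])$ for some given real matrix $\Psi_x[\tau+1]$. Let $\Xi_x[\tau+1]=\mathrm{basis}(\mathrm{null}(\Psi_x[\tau+1]))$ and $$\Gamma=\begin{bmatrix}-\tilde B & \Xi_x[\tau+1]\end{bmatrix},\qquad H_x=\begin{bmatrix} I & 0\end{bmatrix}\Gamma^+\tilde A,\qquad H_\lambda=\begin{bmatrix} I & 0\end{bmatrix}(I-\Gamma^+\Gamma),$$ where $\begin{bmatrix} I & 0\end{bmatrix}$ selects the first block of coordinates, of the dimension of $u[\tau]$. Then the set of admissible inputs at time $\tau$ is $$\mathcal A_u[\tau]=\{\hat u:\ \hat u=H_x x[\tau]+H_\lambda\lambda \ \text{ for some vector } \lambda\}.$$ Also, $x[\tau]\in\mathrm{null}(\Psi_x[\tau])$, where $$\Psi_x[\tau]=\begin{bmatrix}(\Gamma\Gamma^+-I)\tilde A\\ \tilde A_{eq}\end{bmatrix}.$$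
   Context: Fix real matrices $A\in\mathbb R^{n\times n}$, $B\in\mathbb R^{n\times m}$, $C\in\mathbb R^{p\times n}$ (the state, input and output matrices of a linear system). The system-response components $\Phi_{xx}[\tau]\in\mathbb R^{n\times n}$, $\Phi_{xy}[\tau]\in\mathbb R^{n\times p}$, $\Phi_{ux}[\tau]\in\mathbb R^{m\times n}$, $\Phi_{uy}[\tau]\in\mathbb R^{m\times p}$ are vectorized: for a matrix $M$, $\overrightarrow{M}$ is the column vector stacking the columns of $M$, and $$x[\tau]=\begin{bmatrix}\overrightarrow{\Phi_{xx}[\tau]}\\ \overrightarrow{\Phi_{xy}[\tau]}\\ \overrightarrow{\Phi_{ux}[\tau]}\end{bmatrix},\qquad u[\tau]=\overrightarrow{\Phi_{uy}[\tau]}.$$ The matrices $\tilde A,\tilde B,\tilde A_{eq}$ are those for which $x[\tau+1]=\tilde A x[\tau]+\tilde B u[\tau]$ is the vectorized form of $$\Phi_{xx}[\tau+1]=\Phi_{xx}[\tau]A+\Phi_{xy}[\tau]C,\quad \Phi_{xy}[\tau+1]=A\Phi_{xy}[\tau]+B\Phi_{uy}[\tau],\quad \Phi_{ux}[\tau+1]=\Phi_{ux}[\tau]A+\Phi_{uy}[\tau]C,$$ and $\tilde A_{eq}x[\tau]=0$ is the vectorized form of $A\Phi_{xx}[\tau]+B\Phi_{ux}[\tau]=\Phi_{xx}[\tau]A+\Phi_{xy}[\tau]C$. Explicitly, with $\otimes$ the Kronecker product, $$\tilde A=\begin{bmatrix}A^\top\otimes I_n & C^\top\otimes I_n & 0\\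 0& I_p\otimes A&0\\ 0&0&A^\top\otimes I_m\end{bmatrix},\quad \tilde B=\begin{bmatrix}0\\ I_p\otimes B\\ C^\top\otimes I_m\end{bmatrix},\quad \tilde A_{eq}=\begin{bmatrix}I_n\otimes A-A^\top\otimes I_n & -C^\top\otimes I_n & I_n\otimes B\end{bmatrix}.$$ The set of admissible inputs at time $\tau\geq 1$ (given the state $x[\tau]$ and the matrix $\Psi_x[\tau+1]$; no further system-level constraints are imposed) is $\mathcal A_u[\tau]=\{\hat u:\ \tilde A x[\tau]+\tilde B\hat u\in\mathrm{null}(\Psi_x[\tau+1])\}$. Notation: $\mathrm{null}(\Psi)=\{v:\Psi v=0\}$; $\mathrm{basis}(\mathcal S)$ denotes a matrix whose columns form a basis of the linear subspace $\mathcal S$ (it has no columns if $\mathcal S=\{0\}$); $M^+$ is the Moore–Penrose pseudoinverse of $M$; $I$ and $0$ are identity and zero matrices of the dimensions dictated by context. *)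

(* Defs.v *)
From mathcomp Require Import all_boot all_order all_algebra.
From mathcomp Require Import boolp classical_sets reals.
From mathcomp Require Export mxtens.

Set Implicit Arguments.
Unset Strict Implicit.
Unset Printing Implicit Defensive.

Import Order.TTheory GRing.Theory Num.Theory.
Local Open Scope ring_scope.
Local Open Scope classical_set_scope.

(** The Kronecker product is [A *t B] from [mxtens]; its row (and column) index
    [(i, j)] is the ordinal [i * p + j], [p] being the height (width) of [B]. *)

(** Entry [(i, j)] of [M] lands at position [j * m + i]: columns are stacked. *)
Definition vec (R : realType) m n (M : 'M[R]_(m, n)) : 'cV[R]_(n * m) :=
  \col_k M (mxtens_unindex k).2 (mxtens_unindex k).1.

Lemma vec_inj (R : realType) m n : injective (@vec R m n).
Proof.
move=> M N /matrixP e; apply/matrixP => i j.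
by have := e (mxtens_index (j, i)) 0; rewrite !mxE mxtens_indexK.
Qed.

Lemma vecD (R : realType) m n (M N : 'M[R]_(m, n)) : vec (M + N) = vec M + vec N.
Proof. by apply/matrixP => i j; rewrite !mxE. Qed.

Lemma sum_mxtens (R : realType) m n (F : 'I_(m * n) -> R) :
  \sum_k F k = \sum_i \sum_j F (mxtens_index (i, j)).
Proof.
rewrite pair_bigA (reindex (@mxtens_index m n)) /=.
  by apply: eq_bigr => -[].
by exists (@mxtens_unindex m n) => a _; rewrite (mxtens_indexK, mxtens_unindexK).
Qed.

Lemma vec_mull (R : realType) m n q (P : 'M[R]_(q, m)) (M : 'M[R]_(m, n)) :
  vec (P *m M) = (1%:M *t P) *m vec M.
Proof.
apply/colP => k; rewrite !mxE sum_mxtens; case: (mxtens_indexP k) => j i.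
rewrite mxtens_indexK (bigD1 j) //= [X in _ + X]big1 ?addr0 => [|a /negPf aj].
  by apply: eq_bigr => b _; rewrite tensmxE !mxE mxtens_indexK eqxx mul1r.
by apply: big1 => b _; rewrite tensmxE !mxE eq_sym aj !mul0r.
Qed.

Lemma vec_mulr (R : realType) m n q (M : 'M[R]_(m, n)) (Q : 'M[R]_(n, q)) :
  vec (M *m Q) = (Q^T *t 1%:M) *m vec M.
Proof.
apply/colP => k; rewrite !mxE sum_mxtens; case: (mxtens_indexP k) => j i.
rewrite mxtens_indexK; apply: eq_bigr => a _.
rewrite (bigD1 i) //= [X in _ + X]big1 ?addr0 => [|b /negPf bi].
  by rewrite tensmxE !mxE mxtens_indexK eqxx mulr1 mulrC.
by rewrite tensmxE !mxE eq_sym bi mulr0 mul0r.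
Qed.

Section SystemResponse.
Variables (R : realType) (n m p : nat).
Variables (A : 'M[R]_n) (B : 'M[R]_(n, m)) (C : 'M[R]_(p, n)).

Definition xdim := (n * n + p * n + n * m)%N.
Definition udim := (p * m)%N.

Definition xvec (Pxx : 'M[R]_(n, n)) (Pxy : 'M[R]_(n, p)) (Pux : 'M[R]_(m, n)) :
    'cV[R]_xdim :=
  col_mx (col_mx (vec Pxx) (vec Pxy)) (vec Pux).

Definition Atilde : 'M[R]_xdim :=
  col_mx (col_mx
    (row_mx (row_mx (A^T *t (1%:M : 'M_n)) (C^T *t (1%:M : 'M_n))) 0)
    (row_mx (row_mx 0                      ((1%:M : 'M_p) *t A))   0))
    (row_mx (row_mx 0                      0) (A^T *t (1%:M : 'M_m))).

Definition Btilde : 'M[R]_(xdim, udim) :=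
  col_mx (col_mx 0 ((1%:M : 'M_p) *t B)) (C^T *t (1%:M : 'M_m)).

Definition Aeq : 'M[R]_(n * n, xdim) :=
  row_mx (row_mx ((1%:M : 'M_n) *t A - A^T *t (1%:M : 'M_n))
                 (- (C^T *t (1%:M : 'M_n))))
         ((1%:M : 'M_n) *t B).

Lemma dynamics_xvec (Pxx Pxx' : 'M[R]_(n, n)) (Pxy Pxy' : 'M[R]_(n, p))
    (Pux Pux' : 'M[R]_(m, n)) (Puy : 'M[R]_(m, p)) :
  xvec Pxx' Pxy' Pux' = Atilde *m xvec Pxx Pxy Pux + Btilde *m vec Puy <->
  [/\ Pxx' = Pxx *m A + Pxy *m C,
      Pxy' = A *m Pxy + B *m Puy &
      Pux' = Pux *m A + Puy *m C].
Proof.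
rewrite /xvec /Atilde /Btilde !mul_col_mx !mul_row_col !mul0mx.
rewrite ?(addr0, add0r) !add_col_mx addr0.
rewrite -!(vec_mulr, vec_mull) -!vecD; split.
  by case/eq_col_mx => /eq_col_mx[/vec_inj-> /vec_inj->] /vec_inj->.
by case=> -> -> ->.
Qed.

Lemma transition_xvec (Pxx : 'M[R]_(n, n)) (Pxy : 'M[R]_(n, p))
    (Pux : 'M[R]_(m, n)) :
  Aeq *m xvec Pxx Pxy Pux = 0 <->
  A *m Pxx + B *m Pux = Pxx *m A + Pxy *m C.
Proof.
rewrite /xvec /Aeq !mul_row_col mulmxBl mulNmx -!(vec_mulr, vec_mull).
rewrite -addrA (addrC (- vec (Pxy *m C))) addrACA -opprD -!vecD.
split=> [/subr0_eq/vec_inj //|->]; exact: subrr.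
Qed.

End SystemResponse.

Definition null (R : realType) r N (Psi : 'M[R]_(r, N)) : {vspace 'cV[R]_N} :=
  lker (linfun (mulmx Psi)).

(** [basis(S)] is only determined up to the choice of a basis, hence a
    predicate satisfied by every such choice; [k = 0] when [S] is trivial. *)
Definition columns_basis (R : realType) N k (S : {vspace 'cV[R]_N})
    (Xi : 'M[R]_(N, k)) : Prop :=
  basis_of S [seq col j Xi | j <- enum 'I_k].

Definition is_pinv (R : realType) r s (M : 'M[R]_(r, s)) (G : 'M[R]_(s, r)) : Prop :=
  [/\ M *m G *m M = M, G *m M *m G = G,
      (M *m G)^T = M *m G & (G *m M)^T = G *m M].

(** The Moore-Penrose pseudoinverse: the only matrix satisfying the four Penrose
    equations ([pinvP], [pinv_unique]), so the default value [0] is never used. *)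
Definition pinv (R : realType) r s (M : 'M[R]_(r, s)) : 'M[R]_(s, r) :=
  xget 0 [set G | is_pinv M G].

Lemma pinv_unique (R : realType) r s (M : 'M[R]_(r, s)) (G H : 'M[R]_(s, r)) :
  is_pinv M G -> is_pinv M H -> G = H.
Proof.
move=> [mgm gmg mg gm] [mhm hmh mh hm].
have eMG : M *m G = M *m H.
  rewrite -{1}mhm -[_ *m M *m G]mulmxA -mh -mg -trmx_mul.
  by rewrite mulmxA mgm mh.
have eGM : G *m M = H *m M.
  rewrite -{1}mhm 2!mulmxA -mulmxA -gm -hm -trmx_mul.
  by rewrite -mulmxA (mulmxA M) mgm hm.
by rewrite -gmg -mulmxA eMG mulmxA eGM hmh.
Qed.

Lemma gram_unitmx (R : realType) r s (M : 'M[R]_(r, s)) :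
  row_free M -> M *m M^T \in unitmx.
Proof.
move=> fM; rewrite -row_free_unit; apply/inj_row_free => v vMM.
suff: v *m M = 0 by move/eqP; rewrite mulmx_free_eq0 // => /eqP.
have : (v *m M) *m (v *m M)^T = 0.
  by rewrite trmx_mul -mulmxA (mulmxA M) mulmxA vMM mul0mx.
move/matrixP/(_ 0 0); rewrite !mxE => /eqP.
rewrite psumr_eq0 => [/allP h|i _]; last by rewrite [X in _ * X]mxE -expr2 sqr_ge0.
apply/matrixP => i j; rewrite ord1 [RHS]mxE.
by have := h j (mem_index_enum _); rewrite /= [in X in _ * X]mxE mulf_eq0 orbb => /eqP.
Qed.

Lemma pinvP (R : realType) r s (M : 'M[R]_(r, s)) : is_pinv M (pinv M).
Proof.
apply: (@xgetPex _ 0 [set G | is_pinv M G]).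
have [q [P [Q [ME fP fQ]]]] : exists q (P : 'M[R]_(r, q)) (Q : 'M[R]_(q, s)),
    [/\ M = P *m Q, row_full P & row_free Q].
  exists (\rank M), (col_base M), (row_base M).
  by rewrite mulmx_base col_base_full row_base_free.
have uQ : Q *m Q^T \in unitmx by exact: gram_unitmx.
have uP : P^T *m P \in unitmx.
  have := @gram_unitmx R _ _ P^T; rewrite trmxK; apply.
  by rewrite /row_free mxrank_tr.
pose P' := invmx (P^T *m P) *m P^T.
pose Q' := Q^T *m invmx (Q *m Q^T).
have P'P : P' *m P = 1%:M by rewrite /P' -mulmxA mulVmx.
have QQ' : Q *m Q' = 1%:M by rewrite /Q' mulmxA mulmxV.
have MG : M *m (Q' *m P') = P *m P'.
  by rewrite ME mulmxA -(mulmxA P) QQ' mulmx1.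
have GM : Q' *m P' *m M = Q' *m Q.
  by rewrite ME mulmxA -(mulmxA Q') P'P mulmx1.
exists (Q' *m P'); split.
- by rewrite MG ME mulmxA -(mulmxA P) P'P mulmx1.
- by rewrite GM mulmxA -(mulmxA Q') QQ' mulmx1.
- by rewrite MG /P' !trmx_mul trmxK trmx_inv trmx_mul trmxK mulmxA.
- by rewrite GM /Q' !trmx_mul trmxK trmx_inv trmx_mul trmxK mulmxA.
Qed.

Section AdmissibleInputs.
Variables (R : realType) (n m p : nat).
Variables (A : 'M[R]_n) (B : 'M[R]_(n, m)) (C : 'M[R]_(p, n)).

Definition admissible r (x : 'cV[R]_(xdim n m p)) (PsiS : 'M[R]_(r, xdim n m p)) :
    set 'cV[R]_(udim m p) :=
  [set u | Atilde m A C *m x + Btilde B C *m u \in null PsiS].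

Variables (k : nat) (Xi : 'M[R]_(xdim n m p, k)).

Definition Gamma : 'M[R]_(xdim n m p, udim m p + k) := row_mx (- Btilde B C) Xi.

Definition sel : 'M[R]_(udim m p, udim m p + k) := row_mx 1%:M 0.

Definition Hx : 'M[R]_(udim m p, xdim n m p) :=
  sel *m pinv Gamma *m Atilde m A C.

Definition Hlambda : 'M[R]_(udim m p, udim m p + k) :=
  sel *m (1%:M - pinv Gamma *m Gamma).

Definition Psi_prev : 'M[R]_(xdim n m p + n * n, xdim n m p) :=
  col_mx ((Gamma *m pinv Gamma - 1%:M) *m Atilde m A C) (Aeq A B C).

End AdmissibleInputs.

(* Main.v *)
Require Import Defs.
From mathcomp Require Import all_boot all_order all_algebra.
From mathcomp Require Import boolp classical_sets reals.
Import Order.TTheory GRing.Theory Num.Theory.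
Local Open Scope ring_scope.
Local Open Scope classical_set_scope.

(** An input [v] is admissible exactly when the next state it produces lies in
    the column space of [Xi], i.e. when [Atilde x + Btilde v = Xi w] for some
    [w].  Moving [Btilde v] to the right turns this into the linear system
    [Gamma z = Atilde x], whose unknown [z] stacks [v] on top of the auxiliary
    coordinates [w] ([admissibleP]).

    The actual input [u tau] is admissible, so this system is consistent.
    The Penrose equation [Gamma Gamma^+ Gamma = Gamma] then gives both claims
    ([pinv_solutionsP], [pinv_consistent]): the solutions are exactly the
    vectors [Gamma^+ Atilde x + (1 - Gamma^+ Gamma) lambda], whose first block is
    [Hx x + Hlambda lambda]; and consistency itself reads
    [(Gamma Gamma^+ - 1) Atilde x = 0], which, next to the transition constraint,
    is membership of [x] in the null space of [Psi_prev]. *)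

Lemma mem_null (R : realType) r N (Psi : 'M[R]_(r, N)) (v : 'cV[R]_N) :
  (v \in null Psi) = (Psi *m v == 0).
Proof. by rewrite /null memv_ker lfunE. Qed.

Lemma columns_basis_memP {R : realType} {N k} {S : {vspace 'cV[R]_N}}
    {Xi : 'M[R]_(N, k)} (v : 'cV[R]_N) :
  columns_basis S Xi -> v \in S <-> exists w : 'cV[R]_k, v = Xi *m w.
Proof.
have mulE (w : 'cV[R]_k) : Xi *m w = \sum_j w j 0 *: col j Xi.
  apply/colP => i; rewrite summxE mxE.
  by apply: eq_bigr => j _; rewrite !mxE mulrC.
move=> /andP[/eqP spanS _]; split=> [|[w ->]]; last first.
  rewrite mulE -spanS; apply: memv_suml => j _; apply/memvZ/memv_span.
  by apply: map_f; rewrite mem_enum.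
rewrite -spanS span_def big_map big_enum => /memv_sumP[c c_in ->].
have /fin_all_exists[w wE] j : exists a, c j = a *: col j Xi.
  by have /vlineP[a ->] := c_in j isT; exists a.
exists (\col_j w j); rewrite mulE.
by apply: eq_bigr => j _; rewrite wE mxE.
Qed.

Lemma pinv_consistent {R : realType} {r s} {M : 'M[R]_(r, s)} {z : 'cV[R]_s} {b} :
  M *m z = b -> M *m pinv M *m b = b.
Proof. by have [MGM _ _ _] := pinvP M => <-; rewrite mulmxA MGM. Qed.

(** [pinv M *m b] is one solution, and [1 - M^+ M] projects onto the kernel of
    [M]; a solution [z] differs from the first one by its own projection, so
    [lambda := z] recovers it. *)
Lemma pinv_solutionsP {R : realType} {r s} {M : 'M[R]_(r, s)} {b : 'cV[R]_r}
    (z : 'cV[R]_s) :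
  M *m pinv M *m b = b ->
  M *m z = b <->
  exists lambda, z = pinv M *m b + (1%:M - pinv M *m M) *m lambda.
Proof.
have [MGM _ _ _] := pinvP M => consistent; split=> [Mz|[lambda ->]].
  by exists z; rewrite mulmxBl mul1mx -mulmxA Mz addrC subrK.
by rewrite mulmxDr !mulmxA consistent mulmxBr mulmx1 mulmxA MGM subrr mul0mx addr0.
Qed.

Lemma admissibleP {R : realType} {n m p : nat}
    {A : 'M[R]_n} {B : 'M[R]_(n, m)} {C : 'M[R]_(p, n)}
    {x : 'cV[R]_(xdim n m p)} {r : nat} {PsiS : 'M[R]_(r, xdim n m p)}
    {k : nat} {Xi : 'M[R]_(xdim n m p, k)} (v : 'cV[R]_(udim m p)) :
  columns_basis (null PsiS) Xi ->
  admissible A B C x PsiS v <->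
  exists2 z, Gamma B C Xi *m z = Atilde m A C *m x & v = sel R m p k *m z.
Proof.
move=> /columns_basis_memP memXi; rewrite /admissible /= memXi; split.
  case=> w eq_w; exists (col_mx v w).
    by rewrite mul_row_col mulNmx -eq_w addrC addrK.
  by rewrite mul_row_col mul1mx mul0mx addr0.
case=> z; rewrite -[z]vsubmxK !mul_row_col mul1mx mul0mx addr0 => + ->.
by move=> <-; exists (dsubmx z); rewrite mulNmx addrAC addNr add0r.
Qed.

Theorem theorem1 (R : realType) (n m p : nat)
    (A : 'M[R]_n) (B : 'M[R]_(n, m)) (C : 'M[R]_(p, n))
    (tau : nat) (x : nat -> 'cV[R]_(xdim n m p)) (u : nat -> 'cV[R]_(udim m p))
    (r : nat) (PsiS : 'M[R]_(r, xdim n m p))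
    (k : nat) (Xi : 'M[R]_(xdim n m p, k)) :
  (1 <= tau)%N ->
  x tau.+1 = Atilde m A C *m x tau + Btilde B C *m u tau ->
  Aeq A B C *m x tau = 0 ->
  x tau.+1 \in null PsiS ->
  columns_basis (null PsiS) Xi ->
  admissible A B C (x tau) PsiS =
    [set uhat | exists lambda : 'cV[R]_(udim m p + k),
       uhat = Hx A B C Xi *m x tau + Hlambda B C Xi *m lambda]
  /\ x tau \in null (Psi_prev A B C Xi).
Proof.
move=> _ dyn trans x_next basisXi.
have u_adm : admissible A B C (x tau) PsiS (u tau) by rewrite /admissible /= -dyn.
have [z0 /pinv_consistent consistent _] := (admissibleP _ basisXi).1 u_adm.
split; last first.
  by rewrite mem_null mul_col_mx trans -mulmxA mulmxBl consistent mul1mx subrr col_mx0.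
have selE lambda : Hx A B C Xi *m x tau + Hlambda B C Xi *m lambda =
    sel R m p k *m (pinv (Gamma B C Xi) *m (Atilde m A C *m x tau) +
                  (1%:M - pinv (Gamma B C Xi) *m Gamma B C Xi) *m lambda).
  by rewrite /Hx /Hlambda mulmxDr !mulmxA.
apply/seteqP; split=> v /=.
  move=> /(admissibleP _ basisXi)[z /(pinv_solutionsP _ consistent)[lambda ->] ->].
  by exists lambda; rewrite selE.
case=> lambda ->; apply/(admissibleP _ basisXi); rewrite selE.
by eexists; last reflexivity; apply/(pinv_solutionsP _ consistent); exists lambda.
Qed.
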